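(* Let $\mathcal S\colon\mathtt C\to\mathtt{FVec}$ be a stem. For all $c,d\in\mathtt C$ one has $$\mathrm{CP}(\mathcal A_c,\mathcal A_d)=\mathrm{CP}(\mathcal B_c,\mathcal B_d)=\overline{\mathrm{cone}}\ \mathcal S(\mathtt C(c,d)),$$ where the right-hand side is the closed conic hull of $\{\mathcal S(\Phi)\mid\Phi\in\mathtt C(c,d)\}$ in $\mathrm{Lin}(\mathcal S(c),\mathcal S(d))$.
   Context: All vector spaces are finite-dimensional and real; $\mathtt{FVec}$ is the category of these with linear maps, $\mathrm{Lin}(V,W)$ is the space of linear maps, $V'=\mathrm{Lin}(V,\mathbb R)$. A star autonomous category is a symmetric monoidal category $(\mathtt C,\otimes,\mathbf 1)$ with a full and faithful functor ${}^*\colon\mathtt C^{\mathrm{op}}\to\mathtt C$ and a natural bijection $\mathtt C(a\otimes b,c)\cong\mathtt C(a,(b\otimes c^* )^* )$. Write $a\mathbin{\check\otimes}b:=(a^*\otimes b^* )^*$. $\mathtt{FVec}$ is star autonomous with the usual tensor product and dual. A stem is a star autonomous functor $\mathcal S\colon\mathtt C\to\mathtt{FVec}$, where $\mathtt C$ is star autonomous: i.e. a strong monoidal functor with natural isomorphisms $\mathcal S(c^* )\cong\mathcal S(c)'$, such that $\mathcal S$ carries the bijection $\mathtt C(a\otimes b,c)\cong\mathtt C(a,(b\otimes c^* )^* )$ to the corresponding bijection in $\mathtt{FVec}$. These isomorphisms are written as equalities: $\mathcal S(\mathbf 1)=\mathbb R$, $\mathcal S(\mathbf 1^* )=\mathbb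 R'=\mathbb R$, $\mathcal S(c\otimes d)=\mathcal S(c)\otimes\mathcal S(d)=\mathcal S(c\mathbin{\check\otimes}d)$, $\mathcal S(c^* )=\mathcal S(c)'$. For $c\in\mathtt C$: $A(c)=\{v\in\mathcal S(c)\mid\mathcal S(\varphi)(v)\ge 0\ \forall\varphi\in\mathtt C(c,\mathbf 1^* )\}$ and $B(c)=\overline{\mathrm{cone}}\{\mathcal S(\Phi)(1)\mid\Phi\in\mathtt C(\mathbf 1,c)\}$ (closed conic hull). An $\mathcal S$-system $\mathcal G$ on $X$ is a family of closed convex cones $\mathcal G(c)\subseteq X\otimes\mathcal S(c)$, $c\in\mathtt C$, with $(\mathrm{id}_X\otimes\mathcal S(\Phi))(\mathcal G(c))\subseteq\mathcal G(d)$ for all $\Phi\in\mathtt C(c,d)$. For $\mathcal S$-systems $\mathcal G$ on $X$ and $\mathcal E$ on $Y$, $\mathrm{CP}(\mathcal G,\mathcal E)$ is the set of completely positive maps, i.e. of $\Psi\in\mathrm{Lin}(X,Y)$ with $(\Psi\otimes\mathrm{id}_{\mathcal S(c)})(\mathcal G(c))\subseteq\mathcal E(c)$ for all $c\in\mathtt C$. The intrinsic system $\mathcal A_d$ and cointrinsic system $\mathcal B_d$ are the $\mathcal S$-systems on $\mathcal S(d)$ given by $\mathcal A_d(c)=A(d\otimes c)$ and $\mathcal B_d(c)=B(d\mathbin{\check\otimes}c)$, both inside $\mathcal S(d)\otimes\mathcal S(c)$. *)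

(* Defs.v *)
From HB Require Import structures.
From mathcomp Require Import all_boot all_order all_algebra.
From mathcomp Require Import all_classical all_reals all_analysis.

Set Implicit Arguments.
Unset Strict Implicit.
Unset Printing Implicit Defensive.

Import Order.TTheory GRing.Theory Num.Theory.
Import numFieldNormedType.Exports.
Import VectorInternalTheory.

Local Open Scope classical_set_scope.
Local Open Scope ring_scope.

Record category := Category {
  obj :> Type;
  mor : obj -> obj -> Type;
  idmor : forall a, mor a a;
  mcomp : forall a b c, mor b c -> mor a b -> mor a c;
  comp1m : forall a b (f : mor a b), mcomp (idmor b) f = f;
  compm1 : forall a b (f : mor a b), mcomp f (idmor a) = f;
  compmA : forall a b c d (h : mor c d) (g : mor b c) (f : mor a b),
    mcomp h (mcomp g f) = mcomp (mcomp h g) f }.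

Arguments mor {_} _ _.
Arguments idmor {_} _.
Arguments mcomp {_ _ _ _} _ _.

Declare Scope cat_scope.
Delimit Scope cat_scope with cat.
Local Open Scope cat_scope.
Notation "g \c f" := (mcomp g f) (at level 50, left associativity) : cat_scope.

(* Primed structure maps are the two-sided inverses of the unprimed ones. *)
Record smcategory := SMCategory {
  sm_cat :> category;
  ten : sm_cat -> sm_cat -> sm_cat;
  tenm : forall a a' b b', @mor sm_cat a a' -> @mor sm_cat b b' ->
    @mor sm_cat (ten a b) (ten a' b');
  tunit : sm_cat;
  tenm1 : forall a b, tenm (idmor a) (idmor b) = idmor (ten a b);
  tenm_comp : forall a a' a'' b b' b''
    (f' : mor a' a'') (f : mor a a') (g' : mor b' b'') (g : mor b b'),
    tenm (f' \c f) (g' \c g) = tenm f' g' \c tenm f g;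
  assoc : forall a b c, @mor sm_cat (ten (ten a b) c) (ten a (ten b c));
  assoc' : forall a b c, @mor sm_cat (ten a (ten b c)) (ten (ten a b) c);
  assocK : forall a b c, assoc' a b c \c assoc a b c = idmor _;
  assocK' : forall a b c, assoc a b c \c assoc' a b c = idmor _;
  assoc_nat : forall a a' b b' c c' (f : mor a a') (g : mor b b') (h : mor c c'),
    assoc a' b' c' \c tenm (tenm f g) h = tenm f (tenm g h) \c assoc a b c;
  lunit : forall a, @mor sm_cat (ten tunit a) a;
  lunit' : forall a, @mor sm_cat a (ten tunit a);
  lunitK : forall a, lunit' a \c lunit a = idmor _;
  lunitK' : forall a, lunit a \c lunit' a = idmor _;
  lunit_nat : forall a a' (f : mor a a'),
    lunit a' \c tenm (idmor tunit) f = f \c lunit a;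
  runit : forall a, @mor sm_cat (ten a tunit) a;
  runit' : forall a, @mor sm_cat a (ten a tunit);
  runitK : forall a, runit' a \c runit a = idmor _;
  runitK' : forall a, runit a \c runit' a = idmor _;
  runit_nat : forall a a' (f : mor a a'),
    runit a' \c tenm f (idmor tunit) = f \c runit a;
  braid : forall a b, @mor sm_cat (ten a b) (ten b a);
  braidK : forall a b, braid b a \c braid a b = idmor _;
  braid_nat : forall a a' b b' (f : mor a a') (g : mor b b'),
    braid a' b' \c tenm f g = tenm g f \c braid a b;
  pentagon : forall a b c d,
    tenm (idmor a) (assoc b c d) \c assoc a (ten b c) d
      \c tenm (assoc a b c) (idmor d)
    = assoc a b (ten c d) \c assoc (ten a b) c d;
  triangle : forall a b,
    tenm (idmor a) (lunit b) \c assoc a tunit b = tenm (runit a) (idmor b);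
  hexagon : forall a b c,
    tenm (idmor b) (braid a c) \c assoc b a c \c tenm (braid a b) (idmor c)
    = assoc b c a \c braid a (ten b c) \c assoc a b c }.

Arguments ten {_} _ _.
Arguments tenm {_ _ _ _ _} _ _.
Arguments tunit {_}.
Arguments assoc {_} _ _ _.
Arguments assoc' {_} _ _ _.
Arguments lunit {_} _.
Arguments lunit' {_} _.
Arguments runit {_} _.
Arguments runit' {_} _.
Arguments braid {_} _ _.

Record sacategory := SACategory {
  sa_cat :> smcategory;
  star : sa_cat -> sa_cat;
  starm : forall a b, @mor sa_cat a b -> @mor sa_cat (star b) (star a);
  starm1 : forall a, starm (idmor a) = idmor (star a);
  starm_comp : forall a b c (g : mor b c) (f : mor a b),
    starm (g \c f) = starm f \c starm g;
  starm_ff : forall a b, bijective (@starm a b);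
  lcurry : forall a b c,
    @mor sa_cat (ten a b) c -> @mor sa_cat a (star (ten b (star c)));
  curry_bij : forall a b c, bijective (@lcurry a b c);
  curry_nat : forall a a' b b' c c'
    (f : mor a' a) (g : mor b' b) (h : mor c c') (phi : mor (ten a b) c),
    lcurry (h \c phi \c tenm f g)
    = starm (tenm g (starm h)) \c lcurry phi \c f }.

Arguments star {_} _.
Arguments starm {_ _ _} _.
Arguments lcurry {_ _ _ _} _.

Definition par (C : sacategory) (a b : C) : C := star (ten (star a) (star b)).
Definition parm (C : sacategory) (a a' b b' : C) (f : mor a a') (g : mor b b')
  : mor (par a b) (par a' b') := starm (tenm (starm f) (starm g)).

(* A strong monoidal functor (no compatibility with [braid] is required) whose
   isomorphism [sf_dual] : F (star c) = star (F c) is natural; [sf_curry] says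
   that, modulo these isomorphisms, F maps the bijection of C to that of D. *)
Record safunctor (C D : sacategory) := SAFunctor {
  sf_obj :> C -> D;
  sf_hom : forall a b : C, mor a b -> mor (sf_obj a) (sf_obj b);
  sf_hom1 : forall a, sf_hom (idmor a) = idmor (sf_obj a);
  sf_hom_comp : forall (a b c : C) (g : mor b c) (f : mor a b),
    sf_hom (g \c f) = sf_hom g \c sf_hom f;
  sf_unit : mor (@tunit D) (sf_obj tunit);
  sf_unit' : mor (sf_obj tunit) (@tunit D);
  sf_unitK : sf_unit' \c sf_unit = idmor _;
  sf_unitK' : sf_unit \c sf_unit' = idmor _;
  sf_ten : forall a b : C, mor (ten (sf_obj a) (sf_obj b)) (sf_obj (ten a b));
  sf_ten' : forall a b : C, mor (sf_obj (ten a b)) (ten (sf_obj a) (sf_obj b));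
  sf_tenK : forall a b, sf_ten' a b \c sf_ten a b = idmor _;
  sf_tenK' : forall a b, sf_ten a b \c sf_ten' a b = idmor _;
  sf_ten_nat : forall (a a' b b' : C) (f : mor a a') (g : mor b b'),
    sf_hom (tenm f g) \c sf_ten a b = sf_ten a' b' \c tenm (sf_hom f) (sf_hom g);
  sf_assoc : forall a b c : C,
    sf_hom (assoc a b c) \c sf_ten (ten a b) c
      \c tenm (sf_ten a b) (idmor (sf_obj c))
    = sf_ten a (ten b c) \c tenm (idmor (sf_obj a)) (sf_ten b c)
      \c assoc (sf_obj a) (sf_obj b) (sf_obj c);
  sf_lunit : forall a : C,
    sf_hom (lunit a) \c sf_ten tunit a \c tenm sf_unit (idmor (sf_obj a))
    = lunit (sf_obj a);
  sf_runit : forall a : C,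
    sf_hom (runit a) \c sf_ten a tunit \c tenm (idmor (sf_obj a)) sf_unit
    = runit (sf_obj a);
  sf_dual : forall c : C, mor (sf_obj (star c)) (star (sf_obj c));
  sf_dual' : forall c : C, mor (star (sf_obj c)) (sf_obj (star c));
  sf_dualK : forall c, sf_dual' c \c sf_dual c = idmor _;
  sf_dualK' : forall c, sf_dual c \c sf_dual' c = idmor _;
  sf_dual_nat : forall (a b : C) (f : mor a b),
    sf_dual a \c sf_hom (starm f) = starm (sf_hom f) \c sf_dual b;
  sf_curry : forall (a b c : C) (phi : mor (ten a b) c),
    starm (tenm (idmor (sf_obj b)) (sf_dual' c)) \c starm (sf_ten b (star c))
      \c sf_dual (ten b (star c)) \c sf_hom (lcurry phi)
    = lcurry (sf_hom phi \c sf_ten a b) }.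

Section Tensor.
Variable R : realType.
Implicit Types U V W X Y Z : vectType R.

Lemma linfunK U V (f : U -> V) : linear f -> linfun f =1 f.
Proof.
move=> lf x.
pose F : {linear U -> V} := HB.pack f (GRing.isLinear.Build R U V *:%R f lf).
exact: (lfunE F).
Qed.

Lemma lfunD U V (f : 'Hom(U, V)) x y : f (x + y) = f x + f y.
Proof. exact: linearD. Qed.
Lemma lfunZ U V (f : 'Hom(U, V)) k x : f (k *: x) = k *: f x.
Proof. exact: linearZ. Qed.
Lemma lfun_sum U V (f : 'Hom(U, V)) I (r : seq I) (P : pred I) (E : I -> U) :
  f (\sum_(i <- r | P i) E i) = \sum_(i <- r | P i) f (E i).
Proof. exact: linear_sum. Qed.
Definition lfunL := (lfunD, lfunZ).

Definition dual V : vectType R := 'Hom(V, R^o).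
Definition dualm V W (f : 'Hom(V, W)) : 'Hom(dual W, dual V) :=
  linfun (fun g : dual W => (g \o f)%VF).

(* V (x) W is realized as Lin(V', W), with v (x) w : f |-> f(v) w; [tliftE]
   and [tens_ext] are its universal property. *)
Definition tens V W : vectType R := 'Hom(dual V, W).
Definition pure V W (v : V) (w : W) : tens V W :=
  linfun (fun f : dual V => (f v : R) *: w).

Definition vb V : 'I_(\dim {:V}) -> V := fun i => (vbasis {:V})`_i.
Definition cb V (i : 'I_(\dim {:V})) : dual V :=
  linfun (fun v => coord (vbasis {:V}) i v : R^o).

(* The linear map induced by a bilinear map; [tliftE] shows that it does not
   depend on the basis. *)
Definition tlift V W Z (b : V -> W -> Z) : 'Hom(tens V W, Z) :=
  linfun (fun t : tens V W => \sum_i b (vb i) (t (cb i))).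

Definition bilin V W Z (b : V -> W -> Z) :=
  (forall w, linear (b ^~ w)) /\ (forall v, linear (b v)).

Definition tensm V V' W W' (f : 'Hom(V, V')) (g : 'Hom(W, W')) :
  'Hom(tens V W, tens V' W') := tlift (fun v w => pure (f v) (g w)).

Lemma pureE V W (v : V) (w : W) f : pure v w f = (f v : R) *: w.
Proof.
by rewrite linfunK// => k x y; rewrite !lfun_simp scalerDl scalerA.
Qed.

Lemma dualmE V W (f : 'Hom(V, W)) g x : dualm f g x = g (f x).
Proof.
rewrite /dualm linfunK ?comp_lfunE// => k a b.
by apply/lfunP => y; rewrite !lfun_simp.
Qed.

Lemma cbE V i (v : V) : cb i v = coord (vbasis {:V}) i v.
Proof. by rewrite linfunK// => k x y; rewrite linearP. Qed.

Lemma vb_sum V (v : V) : v = \sum_i (cb i v : R) *: vb i.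
Proof.
rewrite [LHS](coord_vbasis (memvf v)); apply: eq_bigr => i _.
by rewrite cbE.
Qed.

Lemma cb_sum V (g : dual V) : g = \sum_i (g (vb i) : R) *: cb i.
Proof.
apply/lfunP => w; rewrite sum_lfunE {1}(vb_sum w) lfun_sum.
by apply: eq_bigr => i _; rewrite lfunZ scale_lfunE; exact: mulrC.
Qed.

Lemma pureP_bilin V W : bilin (@pure V W).
Proof.
split=> [w|v] k x y; apply/lfunP => f; rewrite !lfun_simp !pureE.
  by rewrite !lfunL scalerDl scalerA.
by rewrite scalerDr !scalerA mulrC.
Qed.

Lemma pureDl V W (v v' : V) (w : W) : pure (v + v') w = pure v w + pure v' w.
Proof. by have := (pureP_bilin V W).1 w 1 v v'; rewrite !scale1r. Qed.
Lemma pureDr V W (v : V) (w w' : W) : pure v (w + w') = pure v w + pure v w'.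
Proof. by have := (pureP_bilin V W).2 v 1 w w'; rewrite !scale1r. Qed.
Lemma pure0l V W (w : W) : pure (0 : V) w = 0.
Proof. by apply/lfunP => f; rewrite pureE linear0 scale0r lfunE. Qed.
Lemma pure0r V W (v : V) : pure v (0 : W) = 0.
Proof. by apply/lfunP => f; rewrite pureE scaler0 lfunE. Qed.
Lemma pureZl V W k (v : V) (w : W) : pure (k *: v) w = k *: pure v w.
Proof.
by have := (pureP_bilin V W).1 w k v 0; rewrite pure0l !addr0.
Qed.
Lemma pureZr V W k (v : V) (w : W) : pure v (k *: w) = k *: pure v w.
Proof.
by have := (pureP_bilin V W).2 v k w 0; rewrite pure0r !addr0.
Qed.

Definition pureL := (pureDl, pureDr, pureZl, pureZr).

Lemma pure_sum V W (t : tens V W) : t = \sum_i pure (vb i) (t (cb i)).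
Proof.
apply/lfunP => f; rewrite sum_lfunE.
under eq_bigr do rewrite pureE -linearZ.
rewrite -linear_sum /=; congr (t _); apply/lfunP => v.
rewrite sum_lfunE {1}(vb_sum v) linear_sum; apply: eq_bigr => i _.
by rewrite linearZ /= scale_lfunE; exact: mulrC.
Qed.

Lemma tens_ind V W (P : tens V W -> Prop) :
  (forall v w, P (pure v w)) -> (forall x y, P x -> P y -> P (x + y)) ->
  forall t, P t.
Proof.
move=> Ppure PD t; rewrite (pure_sum t).
apply: big_ind => [||i _]; [|exact: PD|exact: Ppure].
by rewrite -(pure0l V (0 : W)); exact: Ppure.
Qed.

Lemma tens_ext V W Z (f g : 'Hom(tens V W, Z)) :
  (forall v w, f (pure v w) = g (pure v w)) -> f = g.
Proof.
move=> fg; apply/lfunP => t; elim/tens_ind: t => [//|x y fx fy].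
by rewrite !lfunD fx fy.
Qed.

Lemma tliftE V W Z (b : V -> W -> Z) v w :
  bilin b -> tlift b (pure v w) = b v w.
Proof.
move=> [bl br]; rewrite linfunK => [|k x y].
  transitivity (\sum_i (cb i v : R) *: b (vb i) w).
    apply: eq_bigr => i _; rewrite pureE.
    have := br (vb i) (cb i v) w 0; rewrite addr0 => ->.
    by have := br (vb i) (-1) 0 0; rewrite scaler0 addr0 scaleN1r addNr => ->;
      rewrite addr0.
  pose F : {linear V -> Z} :=
    HB.pack (b ^~ w) (GRing.isLinear.Build R V Z *:%R (b ^~ w) (bl w)).
  transitivity (F (\sum_i (cb i v : R) *: vb i)); last by rewrite -vb_sum.
  by rewrite (linear_sum F); apply: eq_bigr => i _; rewrite (linearZ_LR F).
rewrite scaler_sumr -big_split; apply: eq_bigr => i _.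
by rewrite !lfun_simp br.
Qed.

Lemma bilin_tensm V V' W W' (f : 'Hom(V, V')) (g : 'Hom(W, W')) :
  bilin (fun v w => pure (f v) (g w)).
Proof. by split=> [w|v] k x y; rewrite !lfunL !pureL. Qed.

Lemma tensmE V V' W W' (f : 'Hom(V, V')) (g : 'Hom(W, W')) v w :
  tensm f g (pure v w) = pure (f v) (g w).
Proof. by rewrite tliftE//; exact: bilin_tensm. Qed.

Lemma dual_sep V (x y : V) : (forall f : dual V, f x = f y) -> x = y.
Proof. by move=> h; rewrite (vb_sum x) (vb_sum y); apply: eq_bigr => i _; rewrite h. Qed.

Definition fassoc U V W : 'Hom(tens (tens U V) W, tens U (tens V W)) :=
  tlift (fun t w => tlift (fun u v => pure u (pure v w)) t).
Definition fassoc' U V W : 'Hom(tens U (tens V W), tens (tens U V) W) :=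
  tlift (fun u t => tlift (fun v w => pure (pure u v) w) t).
Definition flunit V : 'Hom(tens R^o V, V) := tlift (fun (k : R^o) v => (k : R) *: v).
Definition flunit' V : 'Hom(V, tens R^o V) := linfun (pure (1 : R^o)).
Definition frunit V : 'Hom(tens V R^o, V) :=
  tlift (fun v (k : R^o) => (k : R) *: v).
Definition frunit' V : 'Hom(V, tens V R^o) := linfun (fun v => pure v (1 : R^o)).
Definition fbraid V W : 'Hom(tens V W, tens W V) := tlift (fun v w => pure w v).

(* phi : U (x) V -> W is sent to u |-> (v (x) g |-> g (phi (u (x) v))). *)
Definition fcurry U V W (phi : 'Hom(tens U V, W)) :
    'Hom(U, dual (tens V (dual W))) :=
  linfun (fun u => tlift (fun v (g : dual W) => g (phi (pure u v)))
                   : dual (tens V (dual W))).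

(* v (x) w is sent to the functional f (x) g |-> f(v) g(w). *)
Definition tens_bidual V W : 'Hom(tens V W, dual (tens (dual V) (dual W))) :=
  tlift (fun v w => tlift (fun (f : dual V) (g : dual W) => (f v : R) * g w : R^o)
                    : dual (tens (dual V) (dual W))).

Lemma fassocE U V W (u : U) (v : V) (w : W) :
  fassoc U V W (pure (pure u v) w) = pure u (pure v w).
Proof.
have b1 w' : bilin (fun (u : U) (v : V) => pure u (pure v w')).
  by split=> [?|?] k x y; rewrite !pureL.
rewrite /fassoc tliftE ?tliftE//; split=> [w'|t] k x y; first by rewrite !lfunL.
elim/tens_ind: t => [u' v'|t t' IH IH']; first by rewrite !tliftE// !pureL.
by rewrite !lfunD IH IH'/= scalerDr addrACA.
Qed.

Lemma fassoc'E U V W (u : U) (v : V) (w : W) :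
  fassoc' U V W (pure u (pure v w)) = pure (pure u v) w.
Proof.
have b1 u' : bilin (fun (v : V) (w : W) => pure (pure u' v) w).
  by split=> [?|?] k x y; rewrite !pureL.
rewrite /fassoc' tliftE ?tliftE//; split=> [t|u'] k x y; last by rewrite !lfunL.
elim/tens_ind: t => [u' v'|t t' IH IH']; first by rewrite !tliftE// !pureL.
by rewrite !lfunD IH IH'/= scalerDr addrACA.
Qed.

Lemma flunitE V (k : R^o) (v : V) : flunit V (pure k v) = (k : R) *: v.
Proof.
rewrite /flunit tliftE//; split=> [w|l] x a b; first by rewrite scalerDl scalerA.
by rewrite scalerDr !scalerA mulrC.
Qed.

Lemma frunitE V (k : R^o) (v : V) : frunit V (pure v k) = (k : R) *: v.
Proof.
rewrite /frunit tliftE//; split=> [l|w] x a b; last by rewrite scalerDl scalerA.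
by rewrite scalerDr !scalerA mulrC.
Qed.

Lemma flunit'E V (v : V) : flunit' V v = pure (1 : R^o) v.
Proof. by rewrite /flunit' linfunK// => k x y; rewrite !pureL. Qed.

Lemma frunit'E V (v : V) : frunit' V v = pure v (1 : R^o).
Proof. by rewrite /frunit' linfunK// => k x y; rewrite !pureL. Qed.

Lemma fbraidE V W (v : V) (w : W) : fbraid V W (pure v w) = pure w v.
Proof. by rewrite /fbraid tliftE//; split=> ? k x y; rewrite !pureL. Qed.

Lemma fcurryE U V W (phi : 'Hom(tens U V, W)) u v g :
  fcurry phi u (pure v g) = g (phi (pure u v)).
Proof.
have b1 u' : bilin (fun v (g : dual W) => g (phi (pure u' v))).
  split=> [?|?] k x y; first by rewrite !(pureL, lfunL).
  by rewrite !lfun_simp.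
rewrite /fcurry linfunK ?tliftE// => k x y; apply: tens_ext => v' g'.
by rewrite !lfun_simp !tliftE// !(pureL, lfunL).
Qed.

Lemma tens_bidualE V W (v : V) (w : W) f g :
  tens_bidual V W (pure v w) (pure f g) = (f v : R) * g w.
Proof.
have b1 v' w' :
    bilin (fun (f : dual V) (g : dual W) => (f v' : R) * g w' : R^o).
  split=> [?|?] k x y; rewrite !lfun_simp.
    by rewrite mulrDl -mulrA.
  by rewrite mulrDr mulrCA.
have sE (k x : R^o) : k *: x = (k : R) * x by [].
rewrite /tens_bidual tliftE ?tliftE//; split=> ? k x y; apply: tens_ext => f' g';
  rewrite !lfun_simp !tliftE// !lfunL !sE.
- by rewrite mulrDl -mulrA.
- by rewrite mulrDr mulrCA.
Qed.

End Tensor.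

Section FVec.
Variable R : realType.
Implicit Types U V W X Z : vectType R.

Definition fvec_cat : category :=
  @Category (vectType R) (fun V W => 'Hom(V, W)) (fun V => \1%VF)
    (fun U V W g f => (g \o f)%VF)
    (fun U V f => comp_lfun1l f) (fun U V f => comp_lfun1r f)
    (fun U V W Z h g f => comp_lfunA h g f).

Lemma tens_ext3 U V W Z (f g : 'Hom(tens (tens U V) W, Z)) :
  (forall u v w, f (pure (pure u v) w) = g (pure (pure u v) w)) -> f = g.
Proof.
move=> fg; apply: tens_ext => t w; elim/tens_ind: t => [//|x y fx fy].
by rewrite pureDl !lfunD fx fy.
Qed.

Lemma tens_ext3' U V W Z (f g : 'Hom(tens U (tens V W), Z)) :
  (forall u v w, f (pure u (pure v w)) = g (pure u (pure v w))) -> f = g.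
Proof.
move=> fg; apply: tens_ext => u t; elim/tens_ind: t => [//|x y fx fy].
by rewrite pureDr !lfunD fx fy.
Qed.

Lemma tens_ext4 U V W X Z (f g : 'Hom(tens (tens (tens U V) W) X, Z)) :
  (forall u v w x,
     f (pure (pure (pure u v) w) x) = g (pure (pure (pure u v) w) x)) -> f = g.
Proof.
move=> fg; apply: tens_ext3 => t w x; elim/tens_ind: t => [//|y z fy fz].
by rewrite !pureDl !lfunD fy fz.
Qed.

Definition fvecE := (comp_lfunE, id_lfunE, @tensmE R, @fassocE R, @fassoc'E R,
  @flunitE R, @flunit'E R, @frunitE R, @frunit'E R, @fbraidE R, @dualmE R,
  @fcurryE R, @tens_bidualE R).

Definition fvec_sm : smcategory.
Proof.
refine (@SMCategory fvec_cat (@tens R) (@tensm R) (R^o : vectType R) _ _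
  (@fassoc R) (@fassoc' R) _ _ _ (@flunit R) (@flunit' R) _ _ _
  (@frunit R) (@frunit' R) _ _ _ (@fbraid R) _ _ _ _ _); rewrite /=.
- by move=> V W; apply: tens_ext => v w; rewrite !fvecE.
- by move=> *; apply: tens_ext => v w; rewrite !fvecE.
- by move=> *; apply: tens_ext3 => u v w; rewrite !fvecE.
- by move=> *; apply: tens_ext3' => u v w; rewrite !fvecE.
- by move=> *; apply: tens_ext3 => u v w; rewrite !fvecE.
- move=> V; apply: tens_ext => k v.
  by rewrite !fvecE pureZr -pureZl; congr pure; exact: mulr1.
- by move=> V; apply/lfunP => v; rewrite !fvecE scale1r.
- by move=> *; apply: tens_ext => k v; rewrite !fvecE lfunZ.
- move=> V; apply: tens_ext => v k.
  by rewrite !fvecE pureZl -pureZr; congr pure; exact: mulr1.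
- by move=> V; apply/lfunP => v; rewrite !fvecE scale1r.
- by move=> *; apply: tens_ext => v k; rewrite !fvecE lfunZ.
- by move=> *; apply: tens_ext => v w; rewrite !fvecE.
- by move=> *; apply: tens_ext => v w; rewrite !fvecE.
- by move=> *; apply: tens_ext4 => u v w x; rewrite !fvecE.
- by move=> *; apply: tens_ext3 => v k w; rewrite !fvecE pureZl pureZr.
- by move=> *; apply: tens_ext3 => u v w; rewrite !fvecE.
Defined.

Lemma dualm_bij V W : bijective (@dualm R V W).
Proof.
exists (fun h : 'Hom(dual W, dual V) =>
  linfun (fun v => \sum_i (h (cb i) v : R) *: vb i)) => [f|h].
  apply/lfunP => v; rewrite linfunK => [|k x y].
    rewrite [RHS]vb_sum; apply: eq_bigr => i _.
    by rewrite dualmE.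
  rewrite scaler_sumr -big_split; apply: eq_bigr => i _.
  by rewrite !lfunL scalerDl scalerA.
apply/lfunP => g; apply/lfunP => v; rewrite dualmE linfunK => [|k x y].
  rewrite lfun_sum {2}(cb_sum g) lfun_sum sum_lfunE; apply: eq_bigr => i _.
  by rewrite !lfunZ scale_lfunE; exact: mulrC.
rewrite scaler_sumr -big_split; apply: eq_bigr => i _.
by rewrite !lfunL ?lfun_simp scalerDl scalerA.
Qed.

Lemma fcurry_bij U V W : bijective (@fcurry R U V W).
Proof.
have b1 (psi : 'Hom(U, dual (tens V (dual W)))) :
    bilin (fun u v => \sum_i (psi u (pure v (cb i)) : R) *: vb i).
  split=> [w|w] k x y; rewrite scaler_sumr -big_split; apply: eq_bigr => i _.
    by rewrite !lfunL !lfun_simp scalerDl scalerA.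
  by rewrite !(pureL, lfunL) scalerDl scalerA.
exists (fun psi : 'Hom(U, dual (tens V (dual W))) =>
  tlift (fun u v => \sum_i (psi u (pure v (cb i)) : R) *: vb i)) => [phi|psi].
  apply: tens_ext => u v; rewrite tliftE// [RHS]vb_sum.
  by apply: eq_bigr => i _; rewrite fcurryE.
apply/lfunP => u; apply: tens_ext => v g; rewrite fcurryE tliftE// lfun_sum.
rewrite [in RHS](cb_sum g).
have -> : pure v (\sum_i (g (vb i) : R) *: cb i) =
    \sum_i (g (vb i) : R) *: pure v (cb i).
  by elim/big_rec2: _ => [|i _ t _ <-]; rewrite ?pure0r// !pureL.
by rewrite lfun_sum; apply: eq_bigr => i _; rewrite !lfunZ; exact: mulrC.
Qed.

Definition fvec : sacategory.
Proof.
refine (@SACategory fvec_sm (@dual R) (@dualm R) _ _ (@dualm_bij)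
  (@fcurry R) (@fcurry_bij) _); rewrite /=.
- by move=> V; apply/lfunP => g; apply/lfunP => v; rewrite !fvecE.
- by move=> *; apply/lfunP => ?; apply/lfunP => ?; rewrite !fvecE.
- move=> *; apply/lfunP => ?; apply: tens_ext => ? ?.
  by rewrite !fvecE.
Defined.

End FVec.

Section Cones.
Variable R : realType.
Implicit Types V W : vectType R.

(* The empty combination is allowed: the conic hull of the empty set is {0}. *)
Definition conic_hull V (A : set V) : set V :=
  [set v | exists n (a : 'I_n -> R) (x : 'I_n -> V),
     [/\ forall i, 0 <= a i, forall i, A (x i) & v = \sum_i a i *: x i]].

(* The topology of a finite-dimensional V, read off in the coordinates
   [v2r : V -> 'rV_n], of inverse [r2v]; linear maps are continuous
   ([vclosed_preimage]), so the choice of coordinates is immaterial. *)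
Definition vclosed V (A : set V) : Prop := closed (r2v @^-1` A).
Definition vclosure V (A : set V) : set V := v2r @^-1` closure (r2v @^-1` A).

Definition closed_cone V (A : set V) : set V := vclosure (conic_hull A).

Definition closed_convex_cone V (K : set V) : Prop :=
  [/\ vclosed K, K 0, forall x y, K x -> K y -> K (x + y) &
      forall (a : R) x, 0 <= a -> K x -> K (a *: x)].

Lemma rV_linear_continuous m (W : normedModType R) (f : 'rV[R]_m -> W) :
  linear f -> continuous f.
Proof.
move=> lf.
pose F : {linear 'rV[R]_m -> W} :=
  HB.pack f (GRing.isLinear.Build _ _ _ _ f lf).
have -> : f = (fun u => \sum_j u ord0 j *: F (delta_mx ord0 j)).
  apply/funext => u; rewrite -[f u]/(F u) [in LHS](row_sum_delta u) linear_sum.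
  by apply: eq_bigr => j _; rewrite linearZ.
elim: (index_enum _) => [|j r IH].
  by under eq_fun do rewrite big_nil; exact: cst_continuous.
under eq_fun do rewrite big_cons; move=> u.
apply: (@cvgD _ _ _ _ (nbhs_filter u)); last exact: IH.
apply: (@cvgZr_tmp _ _ _ _ (nbhs_filter u)).
exact: coord_continuous.
Qed.

Lemma vclosed_preimage V W (f : 'Hom(V, W)) (A : set W) :
  vclosed A -> vclosed (f @^-1` A).
Proof.
rewrite /vclosed => clA.
have /(_ _ clA) : forall B, closed B -> closed ((v2r \o f \o r2v) @^-1` B).
  move=> B; apply: preimage_closed => u _; apply: rV_linear_continuous.
  by move=> k x y; rewrite /= !linearP.
by congr closed; apply/funext => u; rewrite /= v2rK.
Qed.

Lemma vclosed_translate V (a : V) (A : set V) :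
  vclosed A -> vclosed [set x | A (x + a)].
Proof.
rewrite /vclosed => clA.
have /(_ _ clA) :
    forall B, closed B -> closed ((fun u : 'rV[R]_(dim V) => u + v2r a) @^-1` B).
  move=> B; apply: preimage_closed => u _.
  apply: (@cvgD _ _ _ _ (nbhs_filter u)); first exact: cvg_id.
  exact: cst_continuous.
by congr closed; apply/funext => u; rewrite /= linearD /= v2rK.
Qed.

Lemma vclosed_closure V (A : set V) : vclosed (vclosure A).
Proof.
rewrite /vclosed /vclosure (_ : _ @^-1` _ = closure (r2v @^-1` A)).
  exact: closed_closure.
by apply/funext => u; rewrite /= r2vK.
Qed.

Lemma sub_vclosure V (A : set V) : A `<=` vclosure A.
Proof. by move=> x Ax; apply: subset_closure; rewrite /= v2rK. Qed.

Lemma vclosure_min V (A K : set V) : A `<=` K -> vclosed K -> vclosure A `<=` K.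
Proof.
move=> AK /closure_id clK x Ax; rewrite -(v2rK x).
suff : (r2v @^-1` K) (v2r x) by [].
by rewrite clK; move: Ax; apply: closureS => u; exact: AK.
Qed.

Lemma conic_hullP V (A : set V) :
  [/\ conic_hull A 0,
      forall x y, conic_hull A x -> conic_hull A y -> conic_hull A (x + y) &
      forall (a : R) x, 0 <= a -> conic_hull A x -> conic_hull A (a *: x)].
Proof.
split=> [|_ _ [m [a [x [a0 Ax ->]]]] [n [b [y [b0 Ay ->]]]]
        |k _ k0 [m [a [x [a0 Ax ->]]]]].
- by exists 0, (fun=> 0), (fun=> 0); split=> [//|[]|]; rewrite ?big_ord0.
- exists (m + n)%N, (fun i : 'I_(m + n) => match fintype.split i with inl j => a j | inr j => b j end),
    (fun i : 'I_(m + n) => match fintype.split i with inl j => x j | inr j => y j end).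
  split=> [i|i|]; try by case: fintype.split.
  rewrite big_split_ord; congr (_ + _); apply: eq_bigr => i _.
    by rewrite -[lshift n i]/(unsplit (inl i)) unsplitK.
  by rewrite -[rshift m i]/(unsplit (inr i)) unsplitK.
exists m, (fun i => k * a i), x; split=> [i|//|]; first exact: mulr_ge0.
by rewrite scaler_sumr; apply: eq_bigr => i _; rewrite scalerA.
Qed.

Lemma closed_coneP V (A : set V) : closed_convex_cone (closed_cone A).
Proof.
have [A0 AD AZ] := conic_hullP A; split.
- exact: vclosed_closure.
- exact: sub_vclosure.
- have D1 x y : conic_hull A x -> closed_cone A y -> closed_cone A (y + x).
    move=> Ax.
    apply: (vclosure_min (K := [set y | closed_cone A (y + x)])) => [z Az|].
      by apply: sub_vclosure; exact: AD.
    by apply: vclosed_translate; exact: vclosed_closure.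
  move=> x y Ax; apply: (vclosure_min (K := [set y | closed_cone A (x + y)])).
    by move=> z Az; exact: D1.
  under eq_set do rewrite addrC.
  by apply: vclosed_translate; exact: vclosed_closure.
- move=> a x a0.
  apply: (vclosure_min (K := [set x | closed_cone A (a *: x)])).
    by move=> z Az; apply: sub_vclosure; exact: AZ.
  have -> : [set x | closed_cone A (a *: x)] =
      (a *: \1%VF : 'Hom(V, V)) @^-1` closed_cone A.
    by apply/funext => z; rewrite /= scale_lfunE id_lfunE.
  by apply: vclosed_preimage; exact: vclosed_closure.
Qed.

Lemma closed_cone_image V W (f : 'Hom(V, W)) (A : set V) (B : set W) :
  f @` A `<=` B -> f @` closed_cone A `<=` closed_cone B.
Proof.
move=> fAB _ [x Ax <-]; move: x Ax.
apply: (vclosure_min (K := f @^-1` closed_cone B)).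
  move=> _ [n [a [x [a0 Ax ->]]]]; apply: sub_vclosure.
  exists n, a, (f \o x); split=> // [i|]; first by apply: fAB; exists (x i).
  by rewrite lfun_sum; apply: eq_bigr => i _; rewrite lfunZ.
by apply: vclosed_preimage; exact: vclosed_closure.
Qed.

Lemma closed_convex_cone_preimage V W (f : 'Hom(V, W)) (K : set W) :
  closed_convex_cone K -> closed_convex_cone (f @^-1` K).
Proof.
move=> [clK K0 KD KZ]; split; first exact: vclosed_preimage.
- by rewrite /= linear0.
- by move=> x y; rewrite /= lfunD; exact: KD.
- by move=> a x a0; rewrite /= lfunZ; exact: KZ.
Qed.

Lemma closed_convex_cone_ge0 V I (f : I -> dual V) :
  closed_convex_cone [set v | forall i, 0 <= (f i v : R)].
Proof.
split=> [|i|x y fx fy i|a x a0 fx i].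
- rewrite /vclosed (_ : _ @^-1` _ =
      \bigcap_i ((f i \o r2v) @^-1` [set y : R | 0 <= y])).
    apply: closed_bigI => i _; apply: preimage_closed; last exact: closed_ge.
    move=> u _; apply: (@rV_linear_continuous _ R^o) => k x y.
    by rewrite /= !linearP.
  by apply/seteqP; split=> v /= h i; [move=> _|]; exact: h.
- by rewrite linear0.
- by rewrite lfunD; exact: addr_ge0.
- by rewrite lfunZ; exact: mulr_ge0.
Qed.

End Cones.

Definition stem (R : realType) (C : sacategory) := safunctor C (fvec R).

Section Stem.
Variables (R : realType) (C : sacategory) (S : stem R C).
Implicit Types (c d : C) (X Y : vectType R).

Definition st_obj c : vectType R := S c.
Definition st_hom c d (Phi : mor c d) : 'Hom(st_obj c, st_obj d) :=
  sf_hom S Phi.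

(* The isomorphisms usually written as equalities: 1 in S(1) = R;
   S(star c) = S(c)'; S(star 1) = R' = R, i.e. evaluation at 1;
   S(c) (x) S(d) = S(c (x) d); and
   S(c) (x) S(d) = (S(c)' (x) S(d)')' = S(star (star c (x) star d)). *)
Definition st_one : st_obj tunit := (sf_unit S : 'Hom(R^o, st_obj tunit)) 1.
Definition st_dual c : 'Hom(st_obj (star c), dual (st_obj c)) := sf_dual S c.
Definition st_dual' c : 'Hom(dual (st_obj c), st_obj (star c)) := sf_dual' S c.
Definition st_scalar (v : st_obj (star tunit)) : R := st_dual tunit v st_one.
Definition st_ten c d :
  'Hom(tens (st_obj c) (st_obj d), st_obj (ten c d)) := sf_ten S c d.
Definition st_ten' c d :
  'Hom(st_obj (ten c d), tens (st_obj c) (st_obj d)) := sf_ten' S c d.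
Definition st_par c d : 'Hom(tens (st_obj c) (st_obj d), st_obj (par c d)) :=
  (st_dual' (ten (star c) (star d)) \o dualm (st_ten' (star c) (star d))
   \o dualm (tensm (st_dual c) (st_dual d))
   \o tens_bidual (st_obj c) (st_obj d))%VF.

Definition Acone c : set (st_obj c) :=
  [set v | forall phi : mor c (star tunit), 0 <= st_scalar (st_hom phi v)].
Definition Bcone c : set (st_obj c) :=
  closed_cone [set st_hom Phi st_one | Phi in [set: mor tunit c]].

Arguments Acone _ _ : clear implicits.
Arguments Bcone _ _ : clear implicits.

Record system X := System {
  sys_cone :> forall c, set (tens X (st_obj c));
  sys_closed : forall c, closed_convex_cone (@sys_cone c);
  sys_hom : forall c d (Phi : mor c d),
    tensm \1%VF (st_hom Phi) @` @sys_cone c `<=` @sys_cone d }.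

Arguments sys_cone {X} _ _ _.

Definition CP X Y (G : system X) (E : system Y) : set 'Hom(X, Y) :=
  [set Psi | forall c, tensm Psi \1%VF @` G c `<=` E c].

Lemma st_hom_comp c d e (g : mor d e) (f : mor c d) v :
  st_hom (g \c f) v = st_hom g (st_hom f v).
Proof.
by rewrite /st_hom -comp_lfunE; congr fun_of_lfun; exact: (sf_hom_comp S g f).
Qed.

Lemma st_ten_nat c c' d d' (f : mor c c') (g : mor d d') t :
  st_hom (tenm f g) (st_ten c d t)
  = st_ten c' d' (tensm (st_hom f) (st_hom g) t).
Proof. by have /lfunP/(_ t) := sf_ten_nat S f g; rewrite !comp_lfunE. Qed.

Lemma st_tenK c d : cancel (st_ten c d) (st_ten' c d).
Proof.
by move=> t; have /lfunP/(_ t) := sf_tenK S c d; rewrite comp_lfunE id_lfunE.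
Qed.

Lemma st_tenK' c d : cancel (st_ten' c d) (st_ten c d).
Proof.
by move=> t; have /lfunP/(_ t) := sf_tenK' S c d; rewrite comp_lfunE id_lfunE.
Qed.

Lemma st_ten'_nat c c' d d' (f : mor c c') (g : mor d d') v :
  st_ten' c' d' (st_hom (tenm f g) v)
  = tensm (st_hom f) (st_hom g) (st_ten' c d v).
Proof. by rewrite -{1}(st_tenK' v) st_ten_nat st_tenK. Qed.

Lemma st_dualK c : cancel (st_dual c) (st_dual' c).
Proof.
by move=> t; have /lfunP/(_ t) := sf_dualK S c; rewrite comp_lfunE id_lfunE.
Qed.

Lemma st_dualK' c : cancel (st_dual' c) (st_dual c).
Proof.
by move=> t; have /lfunP/(_ t) := sf_dualK' S c; rewrite comp_lfunE id_lfunE.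
Qed.

Lemma st_dual_nat c d (f : mor c d) v :
  st_dual c (st_hom (starm f) v) = dualm (st_hom f) (st_dual d v).
Proof. by have /lfunP/(_ v) := sf_dual_nat S f; rewrite !comp_lfunE. Qed.

Lemma st_dual'_nat c d (f : mor c d) v :
  st_hom (starm f) (st_dual' d v) = st_dual' c (dualm (st_hom f) v).
Proof. by rewrite -{2}(st_dualK' v) -st_dual_nat st_dualK. Qed.

Lemma st_par_nat c c' d d' (f : mor c c') (g : mor d d') t :
  st_hom (parm f g) (st_par c d t)
  = st_par c' d' (tensm (st_hom f) (st_hom g) t).
Proof.
rewrite /parm /st_par !comp_lfunE st_dual'_nat; congr (st_dual' _ _).
apply/lfunP => x; rewrite !dualmE st_ten'_nat.
elim/tens_ind: (st_ten' _ _ x) => [p q|y z IHy IHz]; last first.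
  by rewrite !lfunD IHy IHz.
elim/tens_ind: t => [u v|y z IHy IHz]; last first.
  by rewrite !lfunD !add_lfunE IHy IHz.
by rewrite !tensmE !tens_bidualE !st_dual_nat !dualmE.
Qed.

Lemma Acone_closed c : closed_convex_cone (Acone c).
Proof.
pose ev : dual (dual (st_obj tunit)) :=
  linfun (fun f : dual (st_obj tunit) => f st_one).
have := @closed_convex_cone_ge0 R (st_obj c) (mor c (star tunit))
  (fun phi => (ev \o st_dual tunit \o st_hom phi)%VF).
congr closed_convex_cone; apply/funext => v; apply/propext.
have evE f : ev f = f st_one.
  by rewrite linfunK// => k x y; rewrite !lfun_simp.
by split=> h phi; have := h phi; rewrite !comp_lfunE evE.
Qed.

Lemma Acone_hom c d (Phi : mor c d) : st_hom Phi @` Acone c `<=` Acone d.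
Proof. by move=> _ [v Av <-] phi; rewrite -st_hom_comp; exact: Av. Qed.

Lemma Bcone_hom c d (Phi : mor c d) : st_hom Phi @` Bcone c `<=` Bcone d.
Proof.
apply: closed_cone_image => _ [_ [Psi _ <-] <-].
by exists (Phi \c Psi); rewrite ?st_hom_comp.
Qed.

Lemma intrinsic_closed d c :
  closed_convex_cone (st_ten d c @^-1` Acone (ten d c)).
Proof. by apply: closed_convex_cone_preimage; exact: Acone_closed. Qed.

Lemma intrinsic_hom d c c' (Phi : mor c c') :
  tensm \1%VF (st_hom Phi) @` (st_ten d c @^-1` Acone (ten d c))
  `<=` st_ten d c' @^-1` Acone (ten d c').
Proof.
move=> _ [t At <-] /=.
rewrite (_ : \1%VF = st_hom (idmor d)); last by rewrite /st_hom sf_hom1.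
by rewrite -st_ten_nat; apply: Acone_hom; exists (st_ten d c t).
Qed.

Lemma cointrinsic_closed d c :
  closed_convex_cone (st_par d c @^-1` Bcone (par d c)).
Proof. by apply: closed_convex_cone_preimage; exact: closed_coneP. Qed.

Lemma cointrinsic_hom d c c' (Phi : mor c c') :
  tensm \1%VF (st_hom Phi) @` (st_par d c @^-1` Bcone (par d c))
  `<=` st_par d c' @^-1` Bcone (par d c').
Proof.
move=> _ [t Bt <-] /=.
rewrite (_ : \1%VF = st_hom (idmor d)); last by rewrite /st_hom sf_hom1.
by rewrite -st_par_nat; apply: Bcone_hom; exists (st_par d c t).
Qed.

Definition intrinsic d : system (st_obj d) :=
  System (intrinsic_closed d) (@intrinsic_hom d).
Definition cointrinsic d : system (st_obj d) :=
  System (cointrinsic_closed d) (@cointrinsic_hom d).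

End Stem.

Arguments st_hom {R C} S {c d} Phi.

(* Main.v *)
Require Import Defs.
From mathcomp Require Import all_boot all_order all_algebra.
From mathcomp Require Import all_classical all_reals all_analysis.
From mathcomp Require Import ring lra.

(** Write [K] for the closed cone spanned by the maps [st_hom S Phi]. Each
    [st_hom S Phi] is completely positive for both systems, by naturality, and
    completely positive maps form a closed cone; so [K] is contained in both
    sets. The converse inclusions test complete positivity on one well-chosen
    element each.

    For the cointrinsic systems, star autonomy turns the identity of [c] into a
    coevaluation [coeval c : tunit -> par c (star c)], and every morphism
    [tunit -> par d (star c)] is [parm Phi id \c coeval c] for some
    [Phi : c -> d] ([coeval_universal]). Under [S], the coevaluation becomes the
    canonical tensor [coev_tens] of S(c) (x) S(c)', which therefore lies in the
    cone B; a completely positive [Psi] sends it into the cone B of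
    [par d (star c)]. Reading tensors of S(d) (x) S(c)' as linear maps
    ([unname]) returns [Psi] itself and sends the generators of that cone to
    the maps [st_hom S Phi], whence [Psi] is in [K].

    For the intrinsic systems the argument is dual. There is an evaluation
    [eps : ten d (star d) -> star tunit] such that every morphism
    [ten c (star d) -> star tunit] is [eps \c tenm Phi id] for some [Phi], and
    [S] sends [eps] to the evaluation pairing ([st_eval_universal]). If [Psi]
    were not in [K], a functional [L] would be nonnegative on [K] and negative
    at [Psi] ([closed_convex_cone_separation]). Such an [L] is pairing with a
    tensor [t] of S(c) (x) S(d)' ([functional_tensor]); nonnegativity on the
    maps [st_hom S Phi] says exactly that [t] is in the cone A of
    [ten c (star d)], and complete positivity of [Psi], followed by [eps],
    then gives [0 <= L Psi], a contradiction.

    The functor [S] is not assumed to respect the braiding, so all morphisms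
    above are built from currying, stars and the unitors only. *)

Set Implicit Arguments.
Unset Strict Implicit.
Unset Printing Implicit Defensive.

Import Order.TTheory GRing.Theory Num.Theory.
Import numFieldNormedType.Exports.
Import VectorInternalTheory.

Local Open Scope classical_set_scope.
Local Open Scope ring_scope.
Local Open Scope cat_scope.

(** * Separation of a point from a closed convex cone *)

Section Separation.
Variable R : realType.

Definition dotr m (u v : 'rV[R]_m) : R := \sum_j u ord0 j * v ord0 j.

Lemma dotrC m (u v : 'rV[R]_m) : dotr u v = dotr v u.
Proof. by apply: eq_bigr => j _; rewrite mulrC. Qed.

Lemma dotr_linear m (u : 'rV[R]_m) : linear (dotr u : _ -> R^o).
Proof.
move=> k x y; rewrite /dotr scaler_sumr -big_split; apply: eq_bigr => j _.
by rewrite !mxE mulrDr mulrCA.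
Qed.

Lemma dotrDr m (u v w : 'rV[R]_m) : dotr u (v + w) = dotr u v + dotr u w.
Proof. by have := dotr_linear u 1 v w; rewrite !scale1r. Qed.

Lemma dotrZr m (u v : 'rV[R]_m) k : dotr u (k *: v) = k * dotr u v.
Proof. by rewrite /dotr mulr_sumr; apply: eq_bigr => j _; rewrite mxE mulrCA. Qed.

Lemma dotr_sqrD m (z k : 'rV[R]_m) (t : R) :
  dotr (z + t *: k) (z + t *: k) =
  dotr z z + 2 * t * dotr z k + t ^+ 2 * dotr k k.
Proof.
rewrite dotrDr dotrZr ![dotr (_ + _) _]dotrC !dotrDr !dotrZr (dotrC k z).
by ring.
Qed.

Lemma dotrr_ge0 m (u : 'rV[R]_m) : 0 <= dotr u u.
Proof. by apply: sumr_ge0 => j _; rewrite -expr2 sqr_ge0. Qed.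

Lemma dotrr_gt0 m (u : 'rV[R]_m) : u != 0 -> 0 < dotr u u.
Proof.
move=> u0; rewrite lt_neqAle dotrr_ge0 andbT eq_sym.
apply: contra u0 => /eqP u0; apply/eqP/rowP => j; rewrite mxE.
have /psumr_eq0P : forall j, true -> 0 <= u ord0 j * u ord0 j.
  by move=> i _; rewrite -expr2 sqr_ge0.
by move=> /(_ u0 j isT)/eqP; rewrite -expr2 sqrf_eq0 => /eqP.
Qed.

Lemma sqdist_continuous m (x : 'rV[R]_m) :
  continuous (fun u : 'rV[R]_m => dotr (u - x) (u - x)).
Proof.
have -> : (fun u : 'rV[R]_m => dotr (u - x) (u - x)) =
    (fun u => dotr u u + (- 2 * dotr x u + dotr x x)).
  apply/funext => u; have := dotr_sqrD u x (-1).
  by rewrite scaleN1r (dotrC x u) => ->; ring.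
move=> u; apply: (@cvgD _ _ _ _ (nbhs_filter u)).
  rewrite /dotr; elim: (index_enum _) => [|j r IH].
    by under eq_fun do rewrite big_nil; rewrite big_nil; exact: cst_continuous.
  under eq_fun do rewrite big_cons; rewrite big_cons.
  apply: (@cvgD _ _ _ _ (nbhs_filter u)); last exact: IH.
  by apply: (@cvgM _ _ _ (nbhs_filter u)); exact: coord_continuous.
apply: (@cvgD _ _ _ _ (nbhs_filter u)); last exact: cst_continuous.
apply: (@cvgM _ _ _ (nbhs_filter u)); first exact: cst_continuous.
exact: (rV_linear_continuous (dotr_linear x)).
Qed.

(** The points of [A] that are at least as close to [x] as [a] form a compact
    set, on which the squared distance attains its minimum. *)
Lemma nearest_point m (A : set 'rV[R]_m) (x a : 'rV[R]_m) :
  closed A -> A a ->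
  exists2 p, A p & forall y, A y -> dotr (p - x) (p - x) <= dotr (y - x) (y - x).
Proof.
move=> clA Aa; pose N (u : 'rV[R]_m) := dotr (u - x) (u - x).
pose D := A `&` [set u | N u <= N a].
have clD : closed D.
  apply: closedI => //; apply: (@preimage_closed _ _ N [set r | r <= N a]).
    by move=> u _; exact: sqdist_continuous.
  exact: closed_le.
have cD : compact D.
  (* The radius 1 + N a avoids square roots: s ^+ 2 <= N a gives |s| <= 1 + N a. *)
  have cB := @rV_compact R m (fun i =>
    `[x ord0 i - (1 + N a), x ord0 i + (1 + N a)]%classic)
    (fun i => @segment_compact _ _ _).
  apply: subclosed_compact clD cB _ => u [_ /= Nu] i.
  have : (u ord0 i - x ord0 i) ^+ 2 <= N a.
    apply: le_trans Nu; rewrite /N /dotr (bigD1 i)//= !mxE -expr2 lerDl.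
    by apply: sumr_ge0 => j _; rewrite -expr2 sqr_ge0.
  have Na0 : 0 <= N a := dotrr_ge0 _.
  by rewrite /= in_itv /= => h; apply/andP; split; nra.
have [p] := @EVT_min_rV R m N D (ex_intro _ a (conj Aa (lexx _))) cD
  (continuous_subspaceT (@sqdist_continuous _ x)).
rewrite inE => -[Ap pa] pmin; exists p => // y Ay.
have [ya|/ltW ay] := leP (N y) (N a).
  by apply: pmin; rewrite inE.
exact: le_trans ay.
Qed.

(** The functional is the scalar product with [p - x], where [p] is the point
    of [K] nearest to [x]: minimality of the distance makes it nonnegative in
    every direction along which one can move from [p] inside [K]. *)
Lemma closed_convex_cone_separation (V : vectType R) (K : set V) (x : V) :
  closed_convex_cone K -> ~ K x ->
  exists2 f : dual V, forall y, K y -> 0 <= (f y : R) & (f x : R) < 0.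
Proof.
move=> [clK K0 KD KZ] Kx.
have [p Kp pmin] := @nearest_point _ (r2v @^-1` K) (v2r x) 0 clK
  (ltac:(by rewrite /= linear0)).
pose z := p - v2r x.
have z0 : z != 0.
  by apply: contra_notN Kx => /eqP/subr0_eq pE; rewrite -(v2rK x) -pE.
have var k : (forall t : R, 0 <= t <= 1 -> K (r2v (p + t *: k))) ->
    0 <= dotr z k.
  move=> Kpk; rewrite leNgt; apply/negP => zk.
  pose q := dotr k k; have q0 : 0 <= q := dotrr_ge0 k.
  pose w := - dotr z k; have w0 : 0 < w by rewrite oppr_gt0.
  (* A step t <= 1 with t * q < 2 * w decreases the squared distance to x. *)
  pose t := w / (1 + w + q).
  have d0 : 0 < 1 + w + q by lra.
  have tE : t * (1 + w + q) = w by rewrite divfK// gt_eqF.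
  have t0 : 0 < t by rewrite divr_gt0.
  have t1 : t <= 1 by rewrite ler_pdivrMr//; lra.
  have := pmin _ (Kpk t _); rewrite (ltW t0) t1 => /(_ isT).
  rewrite addrAC -/z dotr_sqrD -/q => le.
  have wE : dotr z k = - w by rewrite opprK.
  have tq : t * q < w by nra.
  have : t * (2 * w) <= t * (t * q) by move: le; rewrite wE; lra.
  by rewrite ler_pM2l//; lra.
(* K contains the ray through p, so p can be moved along both p and - p. *)
have zp : dotr z p = 0.
  apply: le_anti; apply/andP; split.
    rewrite -oppr_ge0; have -> : - dotr z p = dotr z (- p).
      by rewrite -(scaleN1r p) dotrZr mulN1r.
    apply: var => t /andP[t0 t1].
    have -> : p + t *: - p = (1 - t) *: p by rewrite scalerBl scale1r scalerN.
    by rewrite linearZ; apply: KZ; rewrite ?subr_ge0.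
  apply: var => t /andP[t0 t1].
  have -> : p + t *: p = (1 + t) *: p by rewrite scalerDl scale1r.
  by rewrite linearZ; apply: KZ; rewrite ?addr_ge0.
have fE (y : V) : linfun (dotr z \o v2r : V -> R^o) y = dotr z (v2r y).
  by rewrite linfunK// => k a b; rewrite /= linearP; exact: dotr_linear.
exists (linfun (dotr z \o v2r : V -> R^o)) => [y Ky|]; rewrite fE.
  apply: var => t /andP[t0 _]; rewrite linearD linearZ /= v2rK.
  by apply: KD => //; exact: KZ.
have -> : v2r x = p + -1 *: z by rewrite scaleN1r opprB addrC subrK.
by rewrite dotrDr zp add0r dotrZr mulN1r oppr_lt0 dotrr_gt0.
Qed.

Lemma sub_closed_cone (V : vectType R) (A : set V) : A `<=` closed_cone A.
Proof.
move=> x Ax; apply: sub_vclosure.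
by exists 1, (fun=> 1), (fun=> x); split=> //; rewrite big_ord1 scale1r.
Qed.

Lemma closed_cone_min (V : vectType R) (A K : set V) :
  closed_convex_cone K -> A `<=` K -> closed_cone A `<=` K.
Proof.
move=> [clK K0 KD KZ] AK; apply: vclosure_min => // _ [n [a [x [a0 Ax ->]]]].
by apply: big_ind => // i _; apply: KZ => //; exact/AK.
Qed.

End Separation.

(** * Coevaluation and evaluation in a star autonomous category *)

Section StarAutonomous.
Variable C : sacategory.
Implicit Types a b c d : C.

Lemma curry_precomp a a' b c (f : mor a' a) (phi : mor (ten a b) c) :
  lcurry (phi \c tenm f (idmor b)) = lcurry phi \c f.
Proof.
have := curry_nat f (idmor b) (idmor c) phi.
by rewrite comp1m starm1 tenm1 starm1 comp1m.
Qed.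

Lemma curry_inj a b c : injective (@lcurry C a b c).
Proof. exact: bij_inj (curry_bij a b c). Qed.

Lemma curry_onto a b c (f : mor a (star (ten b (star c)))) :
  exists phi : mor (ten a b) c, lcurry phi = f.
Proof. by have [g _ K] := curry_bij a b c; exists (g f). Qed.

Lemma starm_onto a b (f : mor (star b) (star a)) :
  exists g : mor a b, starm g = f.
Proof. by have [g _ K] := starm_ff a b; exists (g f). Qed.

Definition inverses a b (f : mor a b) (g : mor b a) :=
  g \c f = idmor a /\ f \c g = idmor b.

Lemma inverses_comp a b c (f : mor a b) f' (g : mor b c) g' :
  inverses f f' -> inverses g g' -> inverses (g \c f) (f' \c g').
Proof.
move=> [f'f ff'] [g'g gg']; split.
  by rewrite -compmA [g' \c _]compmA g'g comp1m.
by rewrite -compmA [f \c _]compmA ff' comp1m.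
Qed.

Lemma inverses_starm a b (f : mor a b) g :
  inverses f g -> inverses (starm f) (starm g).
Proof. by move=> [gf fg]; split; rewrite -starm_comp ?gf ?fg starm1. Qed.

Lemma inverses_tenm a b c d (f : mor a b) f' (g : mor c d) g' :
  inverses f f' -> inverses g g' -> inverses (tenm f g) (tenm f' g').
Proof.
move=> [f'f ff'] [g'g gg'].
by split; rewrite -tenm_comp ?f'f ?g'g ?ff' ?gg' tenm1.
Qed.

(** The Yoneda lemma: mor a d and mor (ten a tunit) d are naturally in
    bijection, and currying identifies the latter with
    mor a (star (ten tunit (star d))). *)
Lemma curry_runit_inverses d : exists g, inverses (lcurry (runit d)) g.
Proof.
have [phi phiE] := curry_onto (idmor (star (ten tunit (star d)))).
have ig : lcurry (runit d) \c (phi \c runit' _) = idmor _.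
  by rewrite -curry_precomp runit_nat -compmA runitK compm1.
have inj f g : lcurry (runit d) \c f = lcurry (runit d) \c g -> f = g :> mor d d.
  rewrite -!curry_precomp !runit_nat => /curry_inj.
  by move=> /(congr1 (fun h => h \c runit' d)); rewrite -!compmA runitK' !compm1.
exists (phi \c runit' _); split=> //.
by apply: inj; rewrite compmA ig comp1m compm1.
Qed.

Definition bidual d : mor d (star (star d)) :=
  starm (lunit' (star d)) \c lcurry (runit d).

Lemma bidual_inverses d : exists g, inverses (bidual d) g.
Proof.
have [g ig] := curry_runit_inverses d.
exists (g \c starm (lunit (star d))); apply: inverses_comp => //.
by apply: inverses_starm; split; [exact: lunitK'|exact: lunitK].
Qed.

Definition coeval c : mor tunit (par c (star c)) := lcurry (lunit (star c)).

(** Since [par d (star c)] unfolds to [star (ten (star d) (star (star c)))],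
    morphisms [tunit -> par d (star c)] are curried morphisms
    [ten tunit (star d) -> star c], that is, morphisms [star d -> star c], and
    these are the stars of morphisms [c -> d]. *)
Lemma coeval_universal c d (psi : mor tunit (par d (star c))) :
  exists Phi : mor c d, psi = parm Phi (idmor (star c)) \c coeval c.
Proof.
have [phi <-] := curry_onto psi.
have [Phi PhiE] := starm_onto (phi \c lunit' (star d)).
exists Phi; have := curry_nat (idmor tunit) (starm Phi) (idmor (star c))
  (lunit (star c)).
rewrite comp1m lunit_nat PhiE -compmA lunitK compm1 => ->.
by rewrite compm1 /parm PhiE.
Qed.

(** Currying takes morphisms [ten c (star d) -> star tunit] to morphisms from
    [c] to [star (ten (star d) (star (star tunit)))], an object that is
    isomorphic to [d] through [bidual] and the right unitor. The evaluation is
    the morphism whose curried form is this isomorphism, and that formula is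
    kept in the conclusion in order to compute the image of [eps] under a
    stem. *)
Lemma eval_universal d : exists (j : mor (star (star tunit)) tunit)
    (eps : mor (ten d (star d)) (star tunit)),
  [/\ j \c bidual tunit = idmor tunit,
    lcurry eps = starm (runit (star d) \c tenm (idmor _) j) \c bidual d &
    forall c (phi : mor (ten c (star d)) (star tunit)),
      exists Phi : mor c d, phi = eps \c tenm Phi (idmor (star d))].
Proof.
have [j ij] := bidual_inverses tunit; have [j' ij'] := bidual_inverses d.
pose kappa := runit (star d) \c tenm (idmor _) j.
have [eps epsE] := curry_onto (starm kappa \c bidual d).
exists j, eps; split=> [|//|c phi]; first by case: ij.
have i1 : inverses (idmor (star d)) (idmor _) by split; rewrite comp1m.
have ir : inverses (runit (star d)) (runit' _).
  by split; [exact: runitK|exact: runitK'].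
have ji : inverses j (bidual tunit) by case: ij.
have ik := inverses_comp (inverses_tenm i1 ji) ir.
have [_ thetaK] := inverses_comp ij' (inverses_starm ik).
exists (j' \c starm (tenm (idmor _) (bidual tunit) \c runit' _) \c lcurry phi).
apply: curry_inj; rewrite curry_precomp epsE.
by rewrite compmA thetaK comp1m.
Qed.

End StarAutonomous.

(** * Images under a stem *)

Section StemCalculus.
Variables (R : realType) (C : sacategory) (S : stem R C).
Implicit Types a b c d : C.

Lemma st_hom_id c : st_hom S (idmor c) = \1%VF.
Proof. exact: (sf_hom1 S c). Qed.

Lemma st_hom1 c (v : st_obj S c) : st_hom S (idmor c) v = v.
Proof. by rewrite st_hom_id id_lfunE. Qed.

Lemma st_curryE a b c (phi : mor (ten a b) c) (u : st_obj S a) (v : st_obj S b)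
    (z : st_obj S (star c)) :
  st_dual S (ten b (star c)) (st_hom S (lcurry phi) u)
    (st_ten S b (star c) (pure v z)) =
  st_dual S c z (st_hom S phi (st_ten S a b (pure u v))).
Proof.
have /lfunP/(_ u)/lfunP/(_ (pure v (st_dual S c z))) := sf_curry S phi.
rewrite /= !comp_lfunE fcurryE dualmE dualmE tensmE id_lfunE comp_lfunE => <-.
by congr (st_dual S _ _ (st_ten S _ _ (pure _ _))); rewrite -[LHS](st_dualK z).
Qed.

Lemma st_lunitE a (v : st_obj S a) :
  st_hom S (lunit a) (st_ten S tunit a (pure (st_one S) v)) = v.
Proof.
have /lfunP/(_ (pure (1 : R^o) v)) := sf_lunit S a.
by rewrite /= !comp_lfunE tensmE id_lfunE flunitE scale1r.
Qed.

Lemma st_runitE a (v : st_obj S a) :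
  st_hom S (runit a) (st_ten S a tunit (pure v (st_one S))) = v.
Proof.
have /lfunP/(_ (pure v (1 : R^o))) := sf_runit S a.
by rewrite /= !comp_lfunE tensmE id_lfunE frunitE scale1r.
Qed.

Lemma st_lunit'E a (v : st_obj S a) :
  st_hom S (lunit' a) v = st_ten S tunit a (pure (st_one S) v).
Proof. by rewrite -{1}(st_lunitE v) -st_hom_comp lunitK st_hom1. Qed.

Lemma st_bidualE d (v : st_obj S d) (y : st_obj S (star d)) :
  st_dual S (star d) (st_hom S (bidual d) v) y = st_dual S d y v.
Proof.
rewrite st_hom_comp st_dual_nat dualmE st_lunit'E.
by rewrite st_curryE st_runitE.
Qed.

Lemma st_parE c d (u : st_obj S c) (v : st_obj S d) y z :
  st_dual S (ten (star c) (star d)) (st_par S c d (pure u v))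
    (st_ten S (star c) (star d) (pure y z)) =
  (st_dual S c y u : R) * st_dual S d z v.
Proof.
rewrite /st_par !comp_lfunE st_dualK' dualmE st_tenK dualmE tensmE.
by rewrite tens_bidualE.
Qed.

Lemma st_par_ext c d (x x' : st_obj S (par c d)) :
  (forall y z, st_dual S (ten (star c) (star d)) x (st_ten S _ _ (pure y z)) =
     st_dual S (ten (star c) (star d)) x' (st_ten S _ _ (pure y z))) -> x = x'.
Proof.
move=> xx'; apply: (can_inj (@st_dualK _ _ S _)); apply/lfunP => t.
rewrite -(st_tenK' t); elim/tens_ind: (st_ten' S _ _ t) => [//|p q IHp IHq].
by rewrite !lfunD IHp IHq.
Qed.

Definition coev_tens c : tens (st_obj S c) (st_obj S (star c)) :=
  \sum_i pure (vb i) (st_dual' S c (cb i)).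

Lemma st_coevalE c :
  st_hom S (coeval c) (st_one S) = st_par S c (star c) (coev_tens c).
Proof.
apply: st_par_ext => y z.
rewrite st_curryE st_lunitE /coev_tens !lfun_sum sum_lfunE.
rewrite -{1}(st_dualK y) (cb_sum (st_dual S c y)) !lfun_sum.
by apply: eq_bigr => i _; rewrite st_parE !lfunZ.
Qed.

(** Linear maps S(c) -> S(d) and elements of S(par d (star c)) correspond to
    each other: [st_par] of [tensm Psi \1 (coev_tens c)] is the name of [Psi],
    and [unname] recovers [Psi] from it, coordinate by coordinate. *)
Definition unname_fun c d (x : st_obj S (par d (star c))) :
    'Hom(st_obj S c, st_obj S d) :=
  linfun (fun w => \sum_i (st_dual S (ten (star d) (star (star c))) x
    (st_ten S _ _ (pure (st_dual' S d (cb i)) (st_hom S (bidual c) w))) : R)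
    *: vb i).

Lemma unname_funE c d x (w : st_obj S c) : @unname_fun c d x w =
  \sum_i (st_dual S (ten (star d) (star (star c))) x
    (st_ten S _ _ (pure (st_dual' S d (cb i)) (st_hom S (bidual c) w))) : R)
    *: vb i.
Proof.
rewrite linfunK// => k u v.
rewrite scaler_sumr -big_split; apply: eq_bigr => i _.
by rewrite !(lfunL, pureL) scalerDl scalerA.
Qed.

Definition unname c d :
    'Hom(st_obj S (par d (star c)), 'Hom(st_obj S c, st_obj S d)) :=
  linfun (@unname_fun c d).

Lemma unnameE c d x : unname c d x = unname_fun x.
Proof.
rewrite /unname linfunK// => k {}x y; apply/lfunP => w.
rewrite !lfun_simp !unname_funE.
rewrite scaler_sumr -big_split; apply: eq_bigr => i _.
by rewrite !lfunL !lfun_simp scalerDl scalerA.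
Qed.

Lemma unnameK c d (Psi : 'Hom(st_obj S c, st_obj S d)) :
  unname c d (st_par S d (star c) (tensm Psi \1%VF (coev_tens c))) = Psi.
Proof.
rewrite unnameE; apply/lfunP => w.
rewrite unname_funE [RHS]vb_sum; apply: eq_bigr => i _.
congr (_ *: _); rewrite /coev_tens !lfun_sum sum_lfunE.
rewrite [in RHS](vb_sum w) !lfun_sum; apply: eq_bigr => j _.
rewrite tensmE id_lfunE st_parE st_bidualE !st_dualK' !lfunZ.
exact: mulrC.
Qed.

Lemma unname_st_hom c d (Phi : mor c d) :
  unname c d (st_hom S (parm Phi (idmor (star c)) \c coeval c) (st_one S)) =
  st_hom S Phi.
Proof. by rewrite st_hom_comp st_coevalE st_par_nat st_hom_id unnameK. Qed.

(** The formula for [lcurry eps] only involves morphisms whose images under [S]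
    are known. The functional [st_scalar] on S(star tunit) is the image of 1
    under [bidual], which brings the left-hand side into the form of
    [st_curryE]; then [j] undoes [bidual] and the unitor removes the 1. *)
Lemma st_eval_universal d : exists eps : mor (ten d (star d)) (star tunit),
  (forall v y,
     st_scalar (st_hom S eps (st_ten S d (star d) (pure v y))) =
     st_dual S d y v) /\
  (forall c (phi : mor (ten c (star d)) (star tunit)),
     exists Phi : mor c d, phi = eps \c tenm Phi (idmor (star d))).
Proof.
have [j [eps [jK epsE eps_univ]]] := eval_universal d.
exists eps; split=> // v y.
rewrite /st_scalar -st_bidualE -st_curryE epsE st_hom_comp st_dual_nat dualmE.
rewrite st_bidualE st_hom_comp st_ten_nat tensmE st_hom1 -st_hom_comp jK.
by rewrite st_hom1 st_runitE.
Qed.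

Definition rank1 (V W : vectType R) (f : dual V) (w : W) : 'Hom(V, W) :=
  linfun (fun v => (f v : R) *: w).

Lemma rank1E (V W : vectType R) (f : dual V) (w : W) v :
  rank1 f w v = (f v : R) *: w.
Proof. by rewrite linfunK// => k x y; rewrite !lfunL scalerDl scalerA. Qed.

Lemma rank1_linear (V W : vectType R) (f : dual V) : linear (@rank1 V W f).
Proof.
move=> k x y; apply/lfunP => v; rewrite !lfun_simp !rank1E.
by rewrite scalerDr !scalerA mulrC.
Qed.

Lemma rank1_sum (V W : vectType R) (Psi : 'Hom(V, W)) :
  Psi = \sum_i rank1 (cb i) (Psi (vb i)).
Proof.
apply/lfunP => v; rewrite sum_lfunE {1}(vb_sum v) lfun_sum.
by apply: eq_bigr => i _; rewrite rank1E lfunZ.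
Qed.

(** S(c) (x) S(d)' is the dual of Lin(S(c), S(d)): [L] is determined by its
    values on rank one maps, and [t] collects the functionals
    [v |-> L (rank1 (cb i) v)]. *)
Lemma functional_tensor c d (L : dual 'Hom(st_obj S c, st_obj S d))
    (eps : mor (ten d (star d)) (star tunit)) :
  (forall v y,
     st_scalar (st_hom S eps (st_ten S d (star d) (pure v y))) =
     st_dual S d y v) ->
  exists t : tens (st_obj S c) (st_obj S (star d)), forall Psi,
    st_scalar (st_hom S eps (st_ten S d (star d) (tensm Psi \1%VF t))) = L Psi.
Proof.
move=> epsE; pose g (i : 'I_(\dim {:st_obj S c})) : dual (st_obj S d) :=
  (L \o linfun (@rank1 (st_obj S c) (st_obj S d) (cb i)))%VF.
have gE i v : g i v = L (rank1 (cb i) v).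
  by rewrite /g comp_lfunE linfunK//; exact: rank1_linear.
exists (\sum_i pure (vb i) (st_dual' S d (g i))) => Psi.
rewrite {2}(rank1_sum Psi) /st_scalar !lfun_sum sum_lfunE.
apply: eq_bigr => i _; rewrite tensmE id_lfunE.
by have := epsE (Psi (vb i)) (st_dual' S d (g i)); rewrite st_dualK' gE.
Qed.

End StemCalculus.

(** * Completely positive maps *)

Section CompletelyPositive.
Variables (R : realType) (C : sacategory) (S : stem R C).
Implicit Types c d e : C.

Lemma tensm_linearl (X Y Z : vectType R) (t : tens X Z) :
  linear (fun Psi : 'Hom(X, Y) => tensm Psi \1%VF t).
Proof.
move=> k f g; elim/tens_ind: t => [x z|p q IHp IHq].
  by rewrite !tensmE !lfun_simp !pureL.
by rewrite !lfunD IHp IHq scalerDr addrACA.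
Qed.

(** For fixed [t] in [G e], the maps [Psi] that send [t] into [E e] form the
    preimage of a closed convex cone under a linear map. *)
Lemma closed_cone_CP (X Y : vectType R) (G : system S X) (E : system S Y)
    (A : set 'Hom(X, Y)) : A `<=` CP G E -> closed_cone A `<=` CP G E.
Proof.
move=> AGE Psi APsi e _ [t Gt <-].
pose f := linfun (fun Psi : 'Hom(X, Y) =>
  tensm Psi (\1%VF : 'Hom(st_obj S e, _)) t).
have fE Phi : f Phi = tensm Phi \1%VF t.
  by rewrite linfunK//; exact: tensm_linearl.
rewrite -fE; apply: (@closed_cone_min _ _ A (f @^-1` E e)) APsi.
  exact/closed_convex_cone_preimage/sys_closed.
by move=> Phi /AGE/(_ e); rewrite /= fE; apply; exists t.
Qed.

Lemma st_hom_CP_intrinsic c d (Phi : mor c d) :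
  CP (intrinsic S c) (intrinsic S d) (st_hom S Phi).
Proof.
move=> e _ [t At <-] /=; rewrite -st_hom_id -st_ten_nat.
by apply: Acone_hom; exists (st_ten S c e t).
Qed.

Lemma st_hom_CP_cointrinsic c d (Phi : mor c d) :
  CP (cointrinsic S c) (cointrinsic S d) (st_hom S Phi).
Proof.
move=> e _ [t Bt <-] /=; rewrite -st_hom_id -st_par_nat.
by apply: Bcone_hom; exists (st_par S c e t).
Qed.

Lemma CP_cointrinsic_sub c d :
  CP (cointrinsic S c) (cointrinsic S d) `<=`
  closed_cone [set st_hom S Phi | Phi in [set: mor c d]].
Proof.
move=> Psi CPPsi; rewrite -(unnameK Psi).
apply: (@closed_cone_image _ _ _ (unname S c d)
  [set st_hom S psi (st_one S) | psi in [set: mor tunit (par d (star c))]]).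
  move=> _ [_ [psi _ <-] <-]; have [Phi ->] := coeval_universal psi.
  by exists Phi => //; rewrite unname_st_hom.
eexists; last by [].
apply: CPPsi; exists (coev_tens S c) => //=; rewrite -st_coevalE.
by apply: sub_closed_cone; exists (coeval c).
Qed.

Lemma CP_intrinsic_sub c d :
  CP (intrinsic S c) (intrinsic S d) `<=`
  closed_cone [set st_hom S Phi | Phi in [set: mor c d]].
Proof.
move=> Psi CPPsi; apply: contrapT => nPsi.
have [L L0] := closed_convex_cone_separation (closed_coneP _) nPsi.
rewrite ltNge => /negP; apply.
have [eps [epsE eps_univ]] := st_eval_universal S d.
have [t tE] := functional_tensor L epsE.
rewrite -tE; apply: (CPPsi (star d)); exists t => //= phi.
have [Phi ->] := eps_univ c phi.
rewrite st_hom_comp st_ten_nat st_hom_id tE; apply: L0.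
by apply: sub_closed_cone; exists Phi.
Qed.

End CompletelyPositive.

Theorem theorem3p21 (R : realType) (C : sacategory) (S : stem R C) (c d : C) :
  CP (intrinsic S c) (intrinsic S d) = CP (cointrinsic S c) (cointrinsic S d) /\
  CP (cointrinsic S c) (cointrinsic S d) =
    closed_cone [set st_hom S Phi | Phi in [set: mor c d]].
Proof.
have A : CP (intrinsic S c) (intrinsic S d) =
    closed_cone [set st_hom S Phi | Phi in [set: mor c d]].
  apply/seteqP; split; first exact: CP_intrinsic_sub.
  by apply: closed_cone_CP => _ [Phi _ <-]; exact: st_hom_CP_intrinsic.
have B : CP (cointrinsic S c) (cointrinsic S d) =
    closed_cone [set st_hom S Phi | Phi in [set: mor c d]].
  apply/seteqP; split; first exact: CP_cointrinsic_sub.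
  by apply: closed_cone_CP => _ [Phi _ <-]; exact: st_hom_CP_cointrinsic.
by rewrite A B.
Qed.
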